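(* Let $n$ and $d_0$ be integers with $2\le d_0\le n-3$, and let $G=G(1,1;d_0,n-d_0-2)$ be the double nested graph with $h=2$, $m_1=m_2=1$, $n_1=d_0$, $n_2=n-d_0-2$ (a quasi-tree graph on $n$ vertices). Then the number of spanning trees of $G$ is $\tau(G)=2^{d_0-1}d_0$.
   Context: A bipartite graph $G$ with bipartition $(U,V)$ is a double nested graph if there are partitions $U=U_1\cup\cdots\cup U_h$ and $V=V_1\cup\cdots\cup V_h$ into non-empty sets such that, for each $1\le i\le h$, the neighborhood of every vertex of $U_i$ is exactly $V_1\cup V_2\cup\cdots\cup V_{h+1-i}$. If $|U_i|=m_i$ and $|V_i|=n_i$, the graph is denoted $G(m_1,\dots,m_h;n_1,\dots,n_h)$. A connected graph is a quasi-tree if deleting some vertex leaves a tree. $\tau(G)$ denotes the number of spanning trees of $G$. *)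

(* Defs.v *)
From mathcomp Require Import all_boot.

Set Implicit Arguments.
Unset Strict Implicit.
Unset Printing Implicit Defensive.

Record sgraph := SGraph {
  svertex :> finType;
  sedge : rel svertex;
  sedge_sym : symmetric sedge;
  sedge_irr : irreflexive sedge }.

Definition edges (G : sgraph) : {set {set G}} :=
  [set A | [exists x : G, exists y : G, sedge x y && (A == [set x; y])]].

Definition is_connected (G : sgraph) : bool :=
  (0 < #|G|) && [forall x : G, forall y : G, connect (@sedge G) x y].

(* [ucycle] also holds of [:: x; y] when x, y are adjacent, so only cycles of
   length at least 3 count; the bound on the length is harmless, see
   [acyclicP]. *)
Definition is_acyclic (G : sgraph) : bool :=
  [forall k : 'I_#|G|.+1, forall c : k.-tuple G,
     ucycleb (@sedge G) c ==> (k <= 2)].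

Lemma acyclicP (G : sgraph) :
  reflect (forall c : seq G, ucycle (@sedge G) c -> size c <= 2)
          (is_acyclic G).
Proof.
apply: (iffP idP) => [acG c cycc | acG].
  have szc : size c < #|G|.+1.
    by rewrite ltnS -(card_uniqP (ucycle_uniq cycc)) max_card.
  have /forallP/(_ (in_tuple c))/implyP := forallP acG (Ordinal szc).
  exact.
apply/forallP=> k; apply/forallP=> c; apply/implyP=> /acG.
by rewrite size_tuple.
Qed.

Definition is_tree (G : sgraph) : bool := is_connected G && is_acyclic G.

Section SpanningTrees.
Variables (G : sgraph) (F : {set {set G}}).

Definition span_rel : rel G :=
  [rel x y | sedge x y && ([set x; y] \in F)].

Lemma span_rel_sym : symmetric span_rel.
Proof. by move=> x y; rewrite /span_rel /= sedge_sym setUC. Qed.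

Lemma span_rel_irr : irreflexive span_rel.
Proof. by move=> x; rewrite /span_rel /= sedge_irr. Qed.

Definition span_graph : sgraph := SGraph span_rel_sym span_rel_irr.

End SpanningTrees.

Definition tau (G : sgraph) : nat :=
  #|[set F : {set {set G}} | (F \subset edges G) && is_tree (span_graph F)]|.

Section DeleteVertex.
Variables (G : sgraph) (v : G).

Definition del_rel : rel {x : G | x != v} :=
  [rel x y | sedge (val x) (val y)].

Lemma del_rel_sym : symmetric del_rel.
Proof. by move=> x y; rewrite /del_rel /= sedge_sym. Qed.

Lemma del_rel_irr : irreflexive del_rel.
Proof. by move=> x; rewrite /del_rel /= sedge_irr. Qed.

Definition del_vertex : sgraph := SGraph del_rel_sym del_rel_irr.

End DeleteVertex.

Definition is_quasi_tree (G : sgraph) : bool :=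
  is_connected G && [exists v : G, is_tree (del_vertex v)].

Definition bipartition (G : sgraph) (A B : {set G}) : Prop :=
  [/\ A :|: B = [set: G], [disjoint A & B]
    & forall x y : G, sedge x y -> (x \in A) = (y \in B)].

Definition indexed_partition (T : finType) (h : nat) (U : 'I_h -> {set T})
    (A : {set T}) : Prop :=
  [/\ \bigcup_i U i = A, forall i, U i != set0
    & forall i j, i != j -> [disjoint U i & U j]].

(* Blocks are indexed from 0: the condition j <= h + 1 - i on indices starting
   at 1 becomes i + j < h. *)
Definition double_nested (G : sgraph) (h : nat) (A B : {set G})
    (U V : 'I_h -> {set G}) : Prop :=
  [/\ bipartition A B, indexed_partition U A, indexed_partition V B
    & forall (i : 'I_h) (x : G), x \in U i ->
        [set y | sedge x y] = \bigcup_(j < h | i + j < h) V j].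

(* G is (a copy of) the graph G(m_1, .., m_h; n_1, .., n_h). *)
Definition is_double_nested_graph (G : sgraph) (h : nat)
    (m n : h.-tuple nat) : Prop :=
  exists (A B : {set G}) (U V : 'I_h -> {set G}),
    [/\ double_nested A B U V, forall i, #|U i| = tnth m i
      & forall i, #|V i| = tnth n i].

Section Model.
Variables (h : nat) (m n : h.-tuple nat).
Hypothesis m_gt0 : forall i, 0 < tnth m i.
Hypothesis n_gt0 : forall i, 0 < tnth n i.

Let T : finType := ({i : 'I_h & 'I_(tnth m i)} + {i : 'I_h & 'I_(tnth n i)})%type.

Definition model_rel : rel T := fun x y =>
  match x, y with
  | inl u, inr v | inr v, inl u => tag u + tag v < h
  | _, _ => false
  end.

Lemma model_rel_sym : symmetric model_rel.
Proof. by case=> ? [] ?. Qed.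

Lemma model_rel_irr : irreflexive model_rel.
Proof. by case. Qed.

Lemma double_nested_graph_exists :
  exists G : sgraph, is_double_nested_graph G m n.
Proof.
exists (SGraph model_rel_sym model_rel_irr).
pose A : {set T} := [set x | if x is inl _ then true else false].
pose U i : {set T} := [set x | if x is inl u then tag u == i else false].
pose V i : {set T} := [set x | if x is inr v then tag v == i else false].
have UE i : U i = [set inl (Tagged (fun i => 'I_(tnth m i)) k) | k in 'I_(tnth m i)].
  apply/setP=> -[[j k]|y]; rewrite inE /=; last by apply/esym/imsetP; case.
  apply/eqP/imsetP => [<-|[k' _]]; first by exists k.
  by move/(congr1 (fun x : T => if x is inl w then tag w else i)).
have VE i : V i = [set inr (Tagged (fun i => 'I_(tnth n i)) k) | k in 'I_(tnth n i)].
  apply/setP=> -[y|[j k]]; rewrite inE /=; first by apply/esym/imsetP; case.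
  apply/eqP/imsetP => [<-|[k' _]]; first by exists k.
  by move/(congr1 (fun x : T => if x is inr w then tag w else i)).
have cU i : #|U i| = tnth m i.
  rewrite UE card_imset ?card_ord // => a b [/eqP].
  by rewrite eq_Tagged => /eqP.
have cV i : #|V i| = tnth n i.
  rewrite VE card_imset ?card_ord // => a b [/eqP].
  by rewrite eq_Tagged => /eqP.
exists A, (~: A), U, V; split=> //; split.
- split; first exact: setUCr.
    by rewrite -setI_eq0 setICr.
  by case=> ? [] ?; rewrite !inE.
- split.
  + apply/setP=> -[u|v]; rewrite inE; apply/bigcupP.
      by exists (tag u) => //; rewrite inE.
    by case=> i _; rewrite inE.
  + by move=> i; rewrite -card_gt0 cU.
  + move=> i j nij; apply/pred0P=> -[u|v]; rewrite /= !inE //.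
    by apply: contraNF nij => /andP[/eqP<- /eqP<-].
- split.
  + apply/setP=> -[u|v]; rewrite !inE /=; apply/bigcupP.
      by case=> i _; rewrite inE.
    by exists (tag v) => //; rewrite inE.
  + by move=> i; rewrite -card_gt0 cV.
  + move=> i j nij; apply/pred0P=> -[u|v]; rewrite /= !inE //.
    by apply: contraNF nij => /andP[/eqP<- /eqP<-].
- move=> i [u|v]; rewrite inE // => /eqP <-.
  apply/setP=> -[u'|v]; rewrite inE /=; first by apply/esym/bigcupP; case=> j _; rewrite inE.
  apply/idP/bigcupP => [lt|[j lt]]; last by rewrite inE => /eqP->.
  by exists (tag v) => //; rewrite inE.
Qed.

End Model.

(* Main.v *)
Require Import Defs.
From mathcomp Require Import all_boot.

(** Write a, b for the single vertices of U_1 and U_2, P for V_1 and Q for V_2: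
    a is joined to all of P and Q, and b to all of P.  In a spanning tree every
    q in Q hangs from a, every p in P is joined to a or to b, and exactly one
    w in P is joined to both: at least one because a and b are connected, at
    most one because w, w' would close the cycle a w b w'.  Hence spanning trees
    correspond to the choice of w and of the set S of the p in P :\ w joined to
    a, which gives d0 * 2 ^ (d0 - 1) of them. *)

Set Implicit Arguments.
Unset Strict Implicit.
Unset Printing Implicit Defensive.

(** * Criteria for acyclicity and connectedness *)

(* On a cycle of length at least 3, a vertex of maximal rank has two distinct
   neighbours of no larger rank. *)
Lemma rank_acyclic (G : sgraph) (r : G -> nat) :
  (forall x y z : G, sedge x y -> sedge x z -> r y <= r x -> r z <= r x ->
     y = z) ->
  is_acyclic G.
Proof.
move=> low; apply/acyclicP=> c /andP[cyc_c uniq_c]; rewrite leqNgt.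
apply/negP=> size_c.
have [x0 x0c] : exists x0, x0 \in c.
  by case: c size_c {cyc_c uniq_c} => // x c _; exists x; rewrite mem_head.
have [x xc x_max] := arg_maxnP r (x0c : [in c] x0).
(* Rotate the cycle so that it starts at the maximal vertex [x]. Its neighbours on the cycle are
   then the second entry [y] and the last entry [z], which differ because no vertex repeats. *)
case/rot_to: (xc : x \in c) => i c' rot_c.
have {}x_max y : y \in x :: c' -> r y <= r x.
  by rewrite -rot_c mem_rot => /x_max.
move: size_c uniq_c cyc_c; rewrite -(size_rot i) -(rot_uniq i) -(rot_cycle i).
rewrite rot_c; case: c' {rot_c} x_max => // y; case/lastP=> // s z x_max _.
rewrite [cycle _ _]/= !rcons_path last_rcons => /and3P[_ + _] /and3P[xy _ zx].
rewrite (low x y z) ?mem_rcons ?mem_head // ?(sedge_sym x) //; apply: x_max.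
  by rewrite !inE eqxx orbT.
by rewrite !inE mem_rcons mem_head !orbT.
Qed.

Lemma connected_to (G : sgraph) (a : G) :
  (forall x : G, connect (@sedge G) x a) -> is_connected G.
Proof.
move=> to_a; apply/andP; split; first by apply/card_gt0P; exists a.
apply/forallP=> x; apply/forallP=> y; apply: connect_trans (to_a x) _.
by rewrite (sym_connect_sym (@sedge_sym G)).
Qed.

Lemma mem_set2_edges (G : sgraph) (x y : G) :
  ([set x; y] \in edges G) = sedge x y.
Proof.
apply/idP/idP => [|xy]; last first.
  by rewrite inE; apply/existsP; exists x; apply/existsP; exists y; rewrite xy eqxx.
rewrite inE => /existsP[u] /existsP[v] /andP[uv /eqP E].
have: u \in [set x; y] by rewrite E set21.
have: v \in [set x; y] by rewrite E set22.
have: x \in [set u; v] by rewrite -E set21.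
have: y \in [set u; v] by rewrite -E set22.
rewrite !inE => hy hx hv hu.
case/orP: hu uv hy hx => /eqP->; case/orP: hv => /eqP-> //; rewrite ?sedge_irr //.
by rewrite sedge_sym.
Qed.

Lemma connected_neighbour (G : sgraph) (x y : G) :
  is_connected G -> x != y -> exists z, sedge x z.
Proof.
case/andP=> _ /forallP/(_ x)/forallP/(_ y)/connectP[[|z p] /=].
  by move=> _ -> /eqP.
by case/andP=> xz _ _ _; exists z.
Qed.

(** * Graphs with two hubs, and the shape of their spanning trees *)

Section TwoHubs.

Variables (G : sgraph) (a b : G) (P Q : {set G}).
Hypotheses (neq_ab : a != b) (aP : a \notin P) (aQ : a \notin Q).
Hypotheses (bP : b \notin P) (bQ : b \notin Q) (dPQ : [disjoint P & Q]).
Hypothesis vertexP : forall x, [|| x == a, x == b, x \in P | x \in Q].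
Hypothesis edge_a : forall x, sedge a x = (x \in P :|: Q).
Hypothesis edge_b : forall x, sedge b x = (x \in P).
Hypothesis edge_hub : forall x y,
  sedge x y -> (x \in [set a; b]) || (y \in [set a; b]).

(** For [w] in [P] and [S] inside [P :\ w], the index sets [Q :|: (w |: S)] and [P :\: S] meet only
    in [w], the one vertex joined to both hubs. *)
Definition hub_tree (w : G) (S : {set G}) : {set {set G}} :=
  [set [set a; x] | x in Q :|: (w |: S)] :|: [set [set b; x] | x in P :\: S].

Lemma neqaP x : x \in P -> x == a = false.
Proof. by move=> xP; apply: contraNF aP => /eqP<-. Qed.
Lemma neqbP x : x \in P -> x == b = false.
Proof. by move=> xP; apply: contraNF bP => /eqP<-. Qed.
Lemma neqaQ x : x \in Q -> x == a = false.
Proof. by move=> xQ; apply: contraNF aQ => /eqP<-. Qed.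
Lemma neqbQ x : x \in Q -> x == b = false.
Proof. by move=> xQ; apply: contraNF bQ => /eqP<-. Qed.

Lemma mem_hub_tree_a w (S : {set G}) x : x \in P :|: Q ->
  ([set a; x] \in hub_tree w S) = (x \in Q :|: (w |: S)).
Proof.
move=> xPQ.
have xa : x == a = false by case/setUP: xPQ => [/neqaP|/neqaQ].
rewrite inE orbC; case: imsetP => [[y /setDP[yP _]] E|_] /=.
  have: a \in [set b; y] by rewrite -E set21.
  by rewrite !inE (negPf neq_ab) eq_sym neqaP.
apply/imsetP/idP => [[y yQ] E|]; last by exists x.
have: x \in [set a; y] by rewrite -E set22.
by rewrite !inE xa => /eqP->; rewrite !inE in yQ.
Qed.

Lemma mem_hub_tree_b w (S : {set G}) x : x \in P -> w \in P -> S \subset P ->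
  ([set b; x] \in hub_tree w S) = (x \notin S).
Proof.
move=> xP wP SP.
rewrite inE; case: imsetP => [[y yT] E|_] /=.
  have: a \in [set b; x] by rewrite E set21.
  by rewrite !inE (negPf neq_ab) eq_sym neqaP.
apply/imsetP/idP => [[y /setDP[yP yS] E]|xS]; last by exists x; rewrite // inE xS.
have: x \in [set b; y] by rewrite -E set22.
by rewrite !inE neqbP // => /eqP->.
Qed.

(** The edges at [b] determine [S], the vertices of [P] not joined to [b]. Then [w] is the only
    vertex of [P] outside [S] that is joined to [a]. *)
Lemma hub_tree_inj w w' (S S' : {set G}) :
  w \in P -> w' \in P -> S \subset P :\ w -> S' \subset P :\ w' ->
  hub_tree w S = hub_tree w' S' -> (w, S) = (w', S').
Proof.
rewrite !subsetD1 => wP w'P /andP[SP wS] /andP[SP' wS'] E.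
have ES : S = S'.
  apply/setP=> x; case xP: (x \in P); last first.
    by rewrite (contraFF (subsetP SP x) xP) (contraFF (subsetP SP' x) xP).
  by apply: negb_inj; rewrite -(mem_hub_tree_b xP wP SP) E mem_hub_tree_b.
move: E; rewrite -ES in wS' *; move=> E.
have : [set a; w] \in hub_tree w' S.
  by rewrite -E mem_hub_tree_a ?inE ?wP ?eqxx ?orbT.
rewrite mem_hub_tree_a ?inE ?wP // (negPf wS) orbF.
by rewrite (disjointFr dPQ wP) => /eqP->.
Qed.

Lemma hub_edge_cases x y : sedge x y ->
  [\/ x = a, x = b, y = a | y = b].
Proof.
case/edge_hub/orP; rewrite !inE => /orP[]/eqP->;
  by [constructor 1|constructor 2|constructor 3|constructor 4].
Qed.

Lemma hub_tree_sub w (S : {set G}) : w \in P -> S \subset P ->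
  hub_tree w S \subset edges G.
Proof.
move=> wP SP; apply/subsetP=> A /setUP[]/imsetP[x + ->]; rewrite mem_set2_edges.
  rewrite edge_a !inE => /or3P[->|/eqP->|/(subsetP SP)->] //; rewrite ?wP ?orbT //.
by rewrite edge_b => /setDP[].
Qed.

Lemma hub_tree_tree w (S : {set G}) :
  w \in P -> S \subset P :\ w -> is_tree (span_graph (hub_tree w S)).
Proof.
rewrite subsetD1 => wP /andP[SP wS]; set F := hub_tree w S.
have ea x : span_rel F a x = (x \in Q :|: (w |: S)).
  rewrite /span_rel /= edge_a; case xPQ: (x \in P :|: Q); first exact: mem_hub_tree_a.
  apply/esym/(contraFF _ xPQ); rewrite !inE => /or3P[->|/eqP->|/(subsetP SP)->] //.
    by rewrite orbT.
  by rewrite wP.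
have eb x : span_rel F b x = (x \in P :\: S).
  rewrite /span_rel /= edge_b in_setD; case: (boolP (x \in P)) => xP.
    by rewrite andbT mem_hub_tree_b.
  by rewrite andbF.
have eC : symmetric (span_rel F) := span_rel_sym F.
apply/andP; split.
  apply: (@connected_to _ (a : span_graph F)) => x /=.
  (* The path b, w, a connects the hubs; every other vertex is adjacent to one of them. *)
  have wa : span_rel F w a by rewrite eC ea !inE eqxx orbT.
  have ba : connect (span_rel F) b a.
    apply: connect_trans (connect1 wa); apply: connect1.
    by rewrite eb inE wS.
  case/or4P: (vertexP x) => [/eqP->|/eqP->|xP|xQ] //.
    case xS : (x \in S); first by apply: connect1; rewrite eC ea !inE xS !orbT.
    by apply: connect_trans ba; apply: connect1; rewrite eC eb inE xS.
  by apply: connect1; rewrite eC ea inE xQ.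
(* Root the tree at [a]: [w] is a child of [a], [b] is a child of [w], and all other vertices are
   leaves, which can share the top rank because no two of them are adjacent. *)
pose r (x : G) := if x == a then 0 else if x == w then 1 else if x == b then 2 else 3.
have wa : w == a = false by apply: neqaP.
have wb : w == b = false by apply: neqbP.
have ra : r a = 0 by rewrite /r eqxx.
have rw : r w = 1 by rewrite /r wa eqxx.
have rb : r b = 2 by rewrite /r eqxx eq_sym (negPf neq_ab) eq_sym wb.
have r_gt0 x : x != a -> 0 < r x.
  by rewrite /r => /negPf->; case: ifP => //; case: ifP.
have r_P x : x \in P -> r x <= 2 -> x = w.
  by move=> xP; rewrite /r neqaP // neqbP //; case: eqP.
(* The unique neighbour of rank at most that of x is the parent of x, for the
   tree rooted at a. *)
pose parent x := if x == w then a else if x == b then w else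
  if x \in P :\: S then b else a.
have low x y : span_rel F x y -> r y <= r x -> y = parent x.
  move=> xy; have /hub_edge_cases : sedge x y by case/andP: xy.
  case=> E; move: xy; rewrite E.
  - rewrite ea ra leqn0 => ya; case: (eqVneq y a) => [yE|/r_gt0]; last by case: (r y).
    move: ya; rewrite yE !inE (negPf aQ) eq_sym wa /=.
    by move/(subsetP SP); rewrite (negPf aP).
  - rewrite eb rb => /setDP[yP _] /(r_P _ yP) ->.
    by rewrite /parent [b == w]eq_sym wb eqxx.
  - rewrite eC ea !inE /parent => h _; case: eqP => // xw.
    case: (x =P b) h => [->|_ /or3P[xQ|/eqP//|xS]].
    + rewrite (negPf bQ) eq_sym wb /=.
      by move/(subsetP SP); rewrite (negPf bP).
    + by rewrite inE (disjointFl dPQ xQ) andbF.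
    + by rewrite inE xS.
  - rewrite eC eb rb /parent => xPS rx; rewrite xPS.
    have xP: x \in P by case/setDP: xPS.
    by case: eqP => [xw|_]; [move: rx; rewrite xw rw | rewrite neqbP].
apply: (@rank_acyclic (span_graph F) r) => x y z xy xz ry rz.
by rewrite (low x y) // (low x z).
Qed.

Lemma spanning_tree_hub (F : {set {set G}}) :
  F \subset edges G -> is_tree (span_graph F) ->
  exists2 w, w \in P & exists2 S : {set G}, S \subset P :\ w & F = hub_tree w S.
Proof.
move=> sFE /andP[conF acF].
have eC : symmetric (span_rel F) := span_rel_sym F.
(* By connectedness every vertex of [P] or [Q] has a neighbour in the tree, which must be a hub; for
   a vertex of [Q] it can only be [a]. *)
have atP p : p \in P -> ([set a; p] \in F) || ([set b; p] \in F).
  move=> pP; have [] := @connected_neighbour _ (p : span_graph F) a conF.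
    by rewrite neqaP.
  move=> z /= /andP[pz pzF]; case: (hub_edge_cases pz) => E.
  - by move: pP; rewrite E (negPf aP).
  - by move: pP; rewrite E (negPf bP).
  - by rewrite -E setUC pzF.
  - by rewrite -E orbC setUC pzF.
have atQ q : q \in Q -> [set a; q] \in F.
  move=> qQ; have [] := @connected_neighbour _ (q : span_graph F) a conF.
    by rewrite neqaQ.
  move=> z /= /andP[qz qzF]; case: (hub_edge_cases qz) => E.
  - by move: qQ; rewrite E (negPf aQ).
  - by move: qQ; rewrite E (negPf bQ).
  - by rewrite -E setUC.
  - by move: qz; rewrite sedge_sym E edge_b (disjointFl dPQ qQ).
have [w wP /andP[wa wb]] : exists2 w, w \in P
    & ([set a; w] \in F) && ([set b; w] \in F).
  apply/exists_inP; apply: contraT => /exists_inPn none.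
  (* If no vertex of [P] is joined to both hubs, then [b] and its tree neighbours form a closed set:
     such a neighbour could leave it only towards [a]. This set misses [a], against
     connectedness. *)
  pose C := [pred x | (x == b) || (x \in P) && ([set b; x] \in F)].
  have closedC : closed (span_rel F) C.
    apply: intro_closed; first exact: sym_connect_sym eC.
    move=> x y /= /andP[xy xyF] /orP[/eqP xb|/andP[xP bxF]]; rewrite !inE.
      by rewrite -edge_b -xb xy xyF orbT.
    case: (hub_edge_cases xy) => E.
    - by move: xP; rewrite E (negPf aP).
    - by move: xP; rewrite E (negPf bP).
    - by have := none x xP; rewrite -E setUC xyF bxF.
    - by rewrite E eqxx.
  case/andP: conF => _ /forallP/(_ b)/forallP/(_ a) /(closed_connect closedC).
  by rewrite !inE eqxx (negPf neq_ab) (negPf aP).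
have w_uniq v : v \in P -> [set a; v] \in F -> [set b; v] \in F -> v = w.
  move=> vP va vb; apply/eqP; apply: contraT => nvw.
  suff /(acyclicP (span_graph F) acF) : ucycle (span_rel F) [:: a; w; b; v] by [].
  have span_a x : x \in P -> [set a; x] \in F -> span_rel F a x.
    by rewrite /span_rel /= edge_a inE => -> ->.
  have span_b x : x \in P -> [set b; x] \in F -> span_rel F b x.
    by rewrite /span_rel /= edge_b => -> ->.
  apply/andP; split.
    by rewrite /cycle /path /rcons span_a // (eC w) !span_b // (eC v) span_a.
  rewrite /= !inE (negPf neq_ab) (eq_sym a w) (eq_sym a v) !neqaP //.
  by rewrite (eq_sym b v) !neqbP // (eq_sym w v) (negPf nvw).
(* Defining [S] by the absence of the edge to [b] makes the edges at [b] agree at once; those at [a]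
   agree by [atP], [atQ] and [w_uniq]. *)
exists w => //; pose S := [set p in P | [set b; p] \notin F].
have SP : S \subset P by apply/subsetP=> p; rewrite inE => /andP[].
have wS : w \notin S by rewrite inE wb andbF.
exists S; first by rewrite subsetD1 SP.
have mem_a x : x \in P :|: Q -> ([set a; x] \in F) = ([set a; x] \in hub_tree w S).
  move=> xPQ; rewrite mem_hub_tree_a // !inE.
  case/setUP: xPQ => [xP|xQ]; last by rewrite xQ atQ.
  rewrite (disjointFr dPQ xP) xP /=; apply/idP/idP => [xa|].
    by case xb: (_ \in F); rewrite ?orbT // (w_uniq x) ?eqxx.
  by case/orP=> [/eqP->|] //; move: (atP x xP) => /orP[->//|->].
have mem_b x : x \in P -> ([set b; x] \in F) = ([set b; x] \in hub_tree w S).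
  by move=> xP; rewrite mem_hub_tree_b // inE xP negbK.
have mem_e x y : sedge x y -> ([set x; y] \in F) = ([set x; y] \in hub_tree w S).
  move=> xy; case: (hub_edge_cases xy) => E; move: xy; rewrite E ?(setUC [set x]).
  - by rewrite edge_a; apply: mem_a.
  - by rewrite edge_b; apply: mem_b.
  - by rewrite sedge_sym edge_a; apply: mem_a.
  - by rewrite sedge_sym edge_b; apply: mem_b.
(* Both sets consist of edges of [G], so comparing them on those edges is enough. *)
apply/setP=> A; case AE: (A \in edges G).
  by move: AE; rewrite inE => /existsP[x] /existsP[y] /andP[xy /eqP->]; apply: mem_e.
have sTE := hub_tree_sub wP SP.
by rewrite (contraFF (subsetP sFE A) AE) (contraFF (subsetP sTE A) AE).
Qed.

(** * Counting the trees, and the quasi-tree property *)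

Lemma tau_two_hubs : tau G = 2 ^ (#|P| - 1) * #|P|.
Proof.
pose D := [set wS : G * {set G} | (wS.1 \in P) && (wS.2 \subset P :\ wS.1)].
have -> : tau G = #|[set hub_tree wS.1 wS.2 | wS in D]|.
  apply: eq_card => F; rewrite inE; apply/andP/imsetP => [[sF tF]|].
    have [w wP [S sS ->]] := spanning_tree_hub sF tF.
    by exists (w, S); rewrite // inE wP.
  case=> -[w S]; rewrite inE /= => /andP[wP sS] ->.
  split; last exact: hub_tree_tree.
  exact: hub_tree_sub wP (subset_trans sS (subD1set _ _)).
rewrite card_in_imset => [|[w S] [w' S']]; last first.
  by rewrite !inE => /andP[wP sS] /andP[w'P sS'] /(hub_tree_inj wP w'P sS sS').
rewrite -sum1_card (eq_bigl _ _ (fun x => in_set _ x)).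
(* Sum over [w] first: each choice leaves a powerset of [P :\ w] for [S]. *)
rewrite -(pair_big_dep (mem P)
  (fun w (S : {set G}) => S \subset P :\ w) (fun _ _ => 1)) /=.
rewrite mulnC -sum_nat_const; apply: eq_bigr => w wP.
have <- : #|P :\ w| = #|P| - 1 by rewrite (cardsD1 w P) wP addKn.
by rewrite -card_powerset -sum1_card; apply: eq_bigl => S; rewrite inE.
Qed.

(** Deleting [b] leaves a star with centre [a]. In [G] itself, [b] reaches [a] through a vertex of
    [P], which is why [P] must be non-empty. *)
Lemma quasi_tree_two_hubs : P != set0 -> is_quasi_tree G.
Proof.
case/set0Pn=> p pP.
have adja x : x \in P :|: Q -> sedge x a by rewrite sedge_sym edge_a.
apply/andP; split.
  apply: (@connected_to _ a) => x; case/or4P: (vertexP x) => [/eqP->|/eqP->|xP|xQ] //.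
  - apply: (@connect_trans _ _ p); apply: connect1; first by rewrite edge_b.
    by apply: adja; rewrite inE pP.
  - by apply: connect1; apply: adja; rewrite inE xP.
  - by apply: connect1; apply: adja; rewrite inE xQ orbT.
apply/existsP; exists b; pose c : del_vertex b := exist _ a neq_ab.
have star (x : del_vertex b) : x != c -> val x \in P :|: Q.
  rewrite -val_eqE /= => xc; have := vertexP (val x).
  by rewrite inE (negPf (valP x)) (negPf xc).
apply/andP; split.
  apply: (@connected_to _ c) => x; case: (eqVneq x c) => [->//|/star xPQ].
  by apply: connect1; apply: adja.
(* Rank 0 at the centre and 1 at the leaves: a leaf has the centre as its only neighbour, and a
   neighbour of the centre of rank 0 would be the centre. *)
apply: (@rank_acyclic _ (fun x => (x != c) : nat)) => x y z xy xz.
have center (u v : del_vertex b) : sedge u v -> u != c -> v = c.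
  move=> uv uc; apply: val_inj.
  have nb (t : del_vertex b) : val t <> b by move/eqP: (valP t).
  by case: (hub_edge_cases uv) => // E;
    [case/eqP: uc; apply: val_inj | case: (nb u) | case: (nb v)].
case: (eqVneq x c) => [xc|xc] /=; last first.
  by move=> _ _; rewrite (center _ _ xy) ?(center _ _ xz).
by case: eqP => // ->; case: eqP => // ->.
Qed.

Lemma card_two_hubs : #|G| = #|P| + #|Q| + 2.
Proof.
have -> : #|G| = #|[set a; b] :|: (P :|: Q)|.
  by rewrite -cardsT; apply: eq_card => x; rewrite !inE -orbA vertexP.
rewrite cardsU cards2 neq_ab cardsU; move: dPQ; rewrite -setI_eq0 => /eqP->.
rewrite (_ : _ :&: _ = set0) ?cards0 ?subn0 1?addnC //.
by apply/setP=> x; rewrite !inE; case: eqP => [->|_]; [|case: eqP => [->|//]];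
  rewrite ?(negPf aP) ?(negPf aQ) ?(negPf bP) ?(negPf bQ).
Qed.

End TwoHubs.

(** * The double nested graph as a graph with two hubs *)

Theorem theorem6 (n d0 : nat) (hd0 : 2 <= d0 <= n - 3) (G : sgraph)
    (hG : is_double_nested_graph G [tuple 1; 1] [tuple d0; n - d0 - 2]) :
  [/\ #|G| = n, is_quasi_tree G & tau G = 2 ^ (d0 - 1) * d0].
Proof.
case: hG => A [B] [U] [V] [[bipAB [coverU _ disjU] [coverV _ disjV] nbh]] cU cV.
case: bipAB => coverAB disjAB edgeAB.
pose i0 : 'I_2 := ord0; pose i1 : 'I_2 := ord_max.
have /eqP/cards1P[a Ua] : #|U i0| = 1 by rewrite cU.
have /eqP/cards1P[b Ub] : #|U i1| = 1 by rewrite cU.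
have big2 (W : 'I_2 -> {set G}) : \bigcup_i W i = W i0 :|: W i1.
  by rewrite big_ord_recl big_ord1; congr (_ :|: W _); apply: val_inj.
rewrite big2 Ua Ub in coverU; rewrite big2 in coverV.
have neq_ab : a != b.
  by have := disjU i0 i1 isT; rewrite Ua Ub disjoints1 inE.
(* With [h = 2], the condition [i + j < h] admits both blocks of [V] for [i = 0] and only the first
   one for [i = 1]. *)
have edge_a x : sedge a x = (x \in V i0 :|: V i1).
  have := nbh i0 a; rewrite Ua set11 => /(_ isT)/setP/(_ x).
  by rewrite inE big_mkcond big2.
have edge_b x : sedge b x = (x \in V i0).
  have := nbh i1 b; rewrite Ub set11 => /(_ isT)/setP/(_ x).
  by rewrite inE big_mkcond big2 /= setU0.
have aB : a \notin V i0 :|: V i1.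
  by rewrite coverV (disjointFr disjAB) // -coverU set21.
have bB : b \notin V i0 :|: V i1.
  by rewrite coverV (disjointFr disjAB) // -coverU set22.
move: (aB) (bB); rewrite !inE => /norP[aV0 aV1] /norP[bV0 bV1].
have vertexP x : [|| x == a, x == b, x \in V i0 | x \in V i1].
  by have := in_setT x; rewrite -coverAB -coverU -coverV !inE -orbA.
have edge_hub x y : sedge x y -> (x \in [set a; b]) || (y \in [set a; b]).
  move=> xy; rewrite coverU; have := in_setT y; rewrite -coverAB inE (edgeAB x y) //.
  by rewrite orbC.
have dV := disjV i0 i1 isT.
have cV0 : #|V i0| = d0 by rewrite cV.
have cV1 : #|V i1| = n - d0 - 2 by rewrite cV.
case/andP: hd0 => d0_ge2 d0_le.
split.
- rewrite (card_two_hubs neq_ab aV0 aV1 bV0 bV1 dV vertexP) cV0 cV1.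
  (* Subtraction is truncated, but [2 <= d0 <= n - 3] forces [n - 3] to be positive; hence
     [d0 + 3 <= n], and [n - d0 - 2] is a true difference. *)
  have n_ge3 : 3 <= n by rewrite ltnW // -subn_gt0 (leq_trans _ d0_le) // ltnW.
  have n_ge : d0 + 3 <= n by rewrite addnC -leq_subRL.
  have n_ge2 : d0 + 2 <= n by rewrite (leq_trans _ n_ge) // leq_add2l.
  by rewrite addnAC -subnDA subnKC.
- apply: (quasi_tree_two_hubs neq_ab vertexP edge_a edge_b edge_hub).
  by rewrite -card_gt0 cV0 ltnW.
- by rewrite -cV0; apply: (tau_two_hubs neq_ab aV0 aV1 bV0 bV1 dV vertexP).
Qed.
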